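(* Let $n\ge 1$ and let $\vec{i}\mapsto (p_{\vec{i}},\nu_{\vec{i}})$, $\vec{i}\in\mathbb{Z}^n$, be a principal contact element net in $\mathbb{R}^3$. Then this net occurs in infinitely many ways as trajectory of a discrete rotating motion (rotation net): there exist an oriented contact element $(p,\nu)$ in the moving space and infinitely many rotation nets $\vec{i}\mapsto a_{\vec{i}}$, $\vec{i}\in\mathbb{Z}^n$, such that for every $\vec{i}\in\mathbb{Z}^n$ the displacement $a_{\vec{i}}$ maps $(p,\nu)$ to $(p_{\vec{i}},\nu_{\vec{i}})$.
   Context: An oriented contact element is a pair $(p,\nu)$ of a point $p\in\mathbb{R}^3$ and an oriented plane $\nu$ through $p$; the oriented line $N$ through $p$ orthogonal to $\nu$ is its axis or normal. For $\vec{i}\in\mathbb{Z}^n$, $\tau_j$ denotes the shift of the index by one in the $j$-th coordinate direction. A contact element net is a map $\vec{i}\mapsto(p_{\vec{i}},\nu_{\vec{i}})$ from $\mathbb{Z}^n$ to oriented contact elements. It is a principal contact element net if any two neighbouring contact elements $(p_{\vec{i}},\nu_{\vec{i}})$ and $\tau_j(p_{\vec{i}},\nu_{\vec{i}})$ have a common oriented tangent sphere, i.e. their normals have a common point (the centre) lying at the same oriented distance from $p_{\vec{i}}$ and $\tau_j p_{\vec{i}}$. Dual quaternions $a=\tilde a+\varepsilon\hat a$ ($\tilde a,\hat a$ quaternions, $\varepsilon^2=0$, $\varepsilon$ commuting with the quaternion units, product $\star$) are identified with vectors $(a_0,\dots,a_7)\in\mathbb{R}^8$, where $\tilde a=(a_0,\dots,a_3)$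 and $\hat a=(a_4,\dots,a_7)$. Put $\langle a,b\rangle=\sum_{i=0}^{3}(a_ib_{i+4}+a_{i+4}b_i)$. The Study quadric is $\mathcal{S}=\{x:\langle x,x\rangle=0\}$ in the projective space $P^7$ over $\mathbb{R}^8$. Its points with $\tilde x\neq0$ correspond bijectively to proper (orientation-preserving) Euclidean displacements from the moving space $\mathbb{R}^3$ to the fixed space $\mathbb{R}^3$: with $a_\varepsilon=\tilde a-\varepsilon\hat a$, and $a$ normalized so that $\Vert\tilde a\Vert=1$, the displacement maps $x\in\mathbb{R}^3$ (viewed as a vector-valued quaternion) to $x'$ given by $1+\varepsilon x'=a_\varepsilon\star(1+\varepsilon x)\star a^{-1}$. Displacements are identified with these points. A rotation net (discrete rotating motion) of dimension $n$ is a map $\vec{i}\mapsto a_{\vec{i}}$ from $\mathbb{Z}^n$ to displacements such that every edge, i.e. the line joining $a_{\vec{i}}$ and $\tau_ja_{\vec{i}}$, is contained in $\mathcal{S}$ (equivalently $\langle a_{\vec{i}},\tau_ja_{\vec{i}}\rangle=0$); geometrically, neighbouring positions correspond in a relative displacement $\tau_ja_{\vec{i}}\star a_{\vec{i}}^{-1}$ that is a pure rotation (the identity being allowed). The trajectory of a contact element $(p,\nu)$ of the moving space is the contact element net of its images under the $a_{\vec{i}}$. *)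

(* Defs.v *)
From HB Require Import structures.
From mathcomp Require Import all_boot all_order all_algebra.
From mathcomp Require Import ring.
From mathcomp Require Import boolp classical_sets functions cardinality reals.

Set Implicit Arguments.
Unset Strict Implicit.
Unset Printing Implicit Defensive.

Import Order.TTheory GRing.Theory Num.Theory.
Local Open Scope ring_scope.

Section Kinematics.
Variable R : realType.

Definition dotv (k : nat) (u v : 'rV[R]_k) : R := (u *m v^T) 0 0.

(* The Euclidean norm; MathComp-Analysis uses the sup norm on matrices. *)
Definition enorm (k : nat) (u : 'rV[R]_k) : R := Num.sqrt (dotv u u).

Notation quat := 'rV[R]_4.

Definition mkquat (a b c d : R) : quat := \row_(i < 4) [:: a; b; c; d]`_i.

Definition qmul (p q : quat) : quat :=
  let: (p0, p1, p2, p3) := (p 0 0, p 0 1, p 0 2, p 0 3) in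
  let: (q0, q1, q2, q3) := (q 0 0, q 0 1, q 0 2, q 0 3) in
  mkquat (p0 * q0 - p1 * q1 - p2 * q2 - p3 * q3)
         (p0 * q1 + p1 * q0 + p2 * q3 - p3 * q2)
         (p0 * q2 - p1 * q3 + p2 * q0 + p3 * q1)
         (p0 * q3 + p1 * q2 - p2 * q1 + p3 * q0).

Definition qone : quat := mkquat 1 0 0 0.

Definition qconj (q : quat) : quat :=
  mkquat (q 0 0) (- q 0 1) (- q 0 2) (- q 0 3).

Definition qinv (q : quat) : quat := (dotv q q)^-1 *: qconj q.

Definition qvec (x : 'rV[R]_3) : quat := mkquat 0 (x 0 0) (x 0 1) (x 0 2).

(* A dual quaternion a + eps b is the vector row_mx a b of R^8, so that its
   primal and dual parts are lsubmx and rsubmx. *)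
Notation dquat := 'rV[R]_(4 + 4).

Definition primal (a : dquat) : quat := lsubmx a.
Definition dual (a : dquat) : quat := rsubmx a.

Definition dqmul (a b : dquat) : dquat :=
  row_mx (qmul (primal a) (primal b))
         (qmul (primal a) (dual b) + qmul (dual a) (primal b)).

Definition dqone : dquat := row_mx qone 0.

(* (u + eps v)^-1 = u^-1 - eps u^-1 v u^-1, for u != 0; see dqmulV, dqmulVr. *)
Definition dqinv (a : dquat) : dquat :=
  let u := qinv (primal a) in row_mx u (- qmul (qmul u (dual a)) u).

Definition eps_conj (a : dquat) : dquat := row_mx (primal a) (- dual a).

(* The point x of R^3 as the dual quaternion 1 + eps x. *)
Definition dqpoint (x : 'rV[R]_3) : dquat := row_mx qone (qvec x).

Definition study_form (a b : dquat) : R :=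
  \sum_(i < 4) (a 0 (lshift 4 i) * b 0 (rshift 4 i)
                + a 0 (rshift 4 i) * b 0 (lshift 4 i)).

(* Sanity checks: dqinv is the two-sided inverse, and the equation defining
   the image of a point under a displacement is always solvable. *)

Lemma rV4P (p q : quat) :
  p 0 0 = q 0 0 -> p 0 1 = q 0 1 -> p 0 2 = q 0 2 -> p 0 3 = q 0 3 -> p = q.
Proof.
move=> e0 e1 e2 e3; apply/rowP => -[[|[|[|[|//]]]] lti].
- by rewrite (_ : Ordinal lti = 0) //; apply/val_inj.
- by rewrite (_ : Ordinal lti = 1) //; apply/val_inj.
- by rewrite (_ : Ordinal lti = 2) //; apply/val_inj.
- by rewrite (_ : Ordinal lti = 3) //; apply/val_inj.
Qed.

Lemma mkquatE (a b c d : R) :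
  (mkquat a b c d 0 0 = a) * (mkquat a b c d 0 1 = b) *
  (mkquat a b c d 0 2 = c) * (mkquat a b c d 0 3 = d).
Proof. by rewrite !mxE. Qed.

Lemma dotv4E (p q : quat) :
  dotv p q = p 0 0 * q 0 0 + p 0 1 * q 0 1 + p 0 2 * q 0 2 + p 0 3 * q 0 3.
Proof.
rewrite /dotv mxE !big_ord_recl big_ord0 !mxE addr0 !addrA.
by congr (_ + _ + _ + _); congr (p _ _ * q _ _); apply/val_inj.
Qed.

Lemma dotv_eq0 (p : quat) : (dotv p p == 0) = (p == 0).
Proof.
apply/eqP/eqP => [|->]; last by rewrite /dotv mul0mx mxE.
rewrite dotv4E -!expr2 => /eqP.
rewrite !paddr_eq0 ?addr_ge0 ?sqr_ge0 // !sqrf_eq0.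
move=> /andP[/andP[/andP[/eqP e0 /eqP e1] /eqP e2] /eqP e3].
by apply: rV4P; rewrite mxE.
Qed.

Lemma qmulA : associative qmul.
Proof. by move=> p q r; apply: rV4P; rewrite !mkquatE; ring. Qed.

Lemma qmul1l : left_id qone qmul.
Proof. by move=> p; apply: rV4P; rewrite !mkquatE; ring. Qed.

Lemma qmul1r : right_id qone qmul.
Proof. by move=> p; apply: rV4P; rewrite !mkquatE; ring. Qed.

Lemma qmulNl (p q : quat) : qmul (- p) q = - qmul p q.
Proof. by apply: rV4P; rewrite !mkquatE !mxE /=; ring. Qed.

Lemma qmulNr (p q : quat) : qmul p (- q) = - qmul p q.
Proof. by apply: rV4P; rewrite !mkquatE !mxE /=; ring. Qed.

Lemma qmulV (p : quat) : p != 0 -> qmul p (qinv p) = qone.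
Proof.
rewrite -dotv_eq0 dotv4E => p0.
by apply: rV4P; rewrite /qinv dotv4E !(mkquatE, mxE) /=; field.
Qed.

Lemma qmulVr (p : quat) : p != 0 -> qmul (qinv p) p = qone.
Proof.
rewrite -dotv_eq0 dotv4E => p0.
by apply: rV4P; rewrite /qinv dotv4E !(mkquatE, mxE) /=; field.
Qed.

Lemma dqmulV (a : dquat) : primal a != 0 -> dqmul a (dqinv a) = dqone.
Proof.
move=> a0; rewrite /dqmul /dqinv /primal /dual !row_mxKl !row_mxKr.
by rewrite qmulV // qmulNr !qmulA qmulV // qmul1l addNr.
Qed.

Lemma dqmulVr (a : dquat) : primal a != 0 -> dqmul (dqinv a) a = dqone.
Proof.
move=> a0; rewrite /dqmul /dqinv /primal /dual !row_mxKl !row_mxKr.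
by rewrite qmulVr // qmulNl -!qmulA qmulVr // qmul1r addrN.
Qed.

Lemma study_formE (a b : dquat) :
  study_form a b = dotv (primal a) (dual b) + dotv (dual a) (primal b).
Proof.
rewrite /study_form /dotv !mxE -big_split /=.
by apply: eq_bigr => i _; rewrite !mxE.
Qed.

Lemma dqpoint_image (a : dquat) (x : 'rV[R]_3) :
    primal a != 0 -> study_form a a = 0 ->
  exists x', dqpoint x' = dqmul (dqmul (eps_conj a) (dqpoint x)) (dqinv a).
Proof.
move=> a0; rewrite study_formE => S.
set y := dqmul _ _.
exists (\row_(i < 3) dual y 0 (lift 0 i)).
rewrite -[RHS]hsubmxK /dqpoint; congr row_mx.
  by rewrite /y /dqmul /dqinv /eps_conj /dqpoint /primal !row_mxKl qmul1r qmulV.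
suff y0 : dual y 0 0 = 0.
  by apply: rV4P; rewrite mkquatE ?[RHS]y0 // mxE; congr (_ 0 _); apply/val_inj.
move: S a0; rewrite -dotv_eq0 !dotv4E.
rewrite /y /dqmul /dqinv /eps_conj /dqpoint /primal /dual !row_mxKl !row_mxKr.
move: (lsubmx a) (rsubmx a) => u v S u0.
have S' : v 0 0 * u 0 0 + v 0 1 * u 0 1 + v 0 2 * u 0 2 + v 0 3 * u 0 3 = 0.
  by apply: (@mulfI _ 2); rewrite ?pnatr_eq0 // mulr0 -S; ring.
rewrite qmul1r qmulNr !qmulA qmulV ?qmul1l -?dotv_eq0 ?dotv4E //.
rewrite /qinv dotv4E; set d := _^-1.
rewrite !(mkquatE, mxE) /=.
rewrite [LHS](_ : _ = - 2 * d * (v 0 0 * u 0 0 + v 0 1 * u 0 1 + v 0 2 * u 0 2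
  + v 0 3 * u 0 3)); last by ring.
by rewrite S' mulr0.
Qed.

(* P^7 as the set of lines through the origin of R^8. *)
Definition proj7 := {U : {vspace dquat} | \dim U == 1%N}.

(* When x = y the line degenerates to a point. *)
Definition joining_line (x y : proj7) : {vspace dquat} := (val x + val y)%VS.

Definition in_study_quadric (U : {vspace dquat}) : Prop :=
  forall v, v \in U -> study_form v v = 0.

Definition is_displacement (x : proj7) : Prop :=
  in_study_quadric (val x) /\ (forall v, v \in val x -> v != 0 -> primal v != 0).

Definition maps_point (x : proj7) (p p' : 'rV[R]_3) : Prop :=
  exists a : dquat, [/\ a \in val x, enorm (primal a) = 1 &
    dqpoint p' = dqmul (dqmul (eps_conj a) (dqpoint p)) (dqinv a)].

(* The oriented plane is encoded by its unit normal vector. *)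
Record contact_element := ContactElement {
  foot : 'rV[R]_3;
  normal : 'rV[R]_3;
  normal_unit : enorm normal = 1
}.

Definition axis (E : contact_element) : set 'rV[R]_3 :=
  [set foot E + t *: normal E | t in setT].

(* The oriented distance along the axis, for m on the axis of E. *)
Definition oriented_dist (E : contact_element) (m : 'rV[R]_3) : R :=
  dotv (m - foot E) (normal E).

Definition common_tangent_sphere (E F : contact_element) : Prop :=
  exists m, [/\ axis E m, axis F m & oriented_dist E m = oriented_dist F m].

(* An affine map sends the normal vector of E to that of F when it sends
   foot E + normal E to foot F + normal F, the foot points corresponding. *)
Definition maps_contact (x : proj7) (E F : contact_element) : Prop :=
  maps_point x (foot E) (foot F) /\
  maps_point x (foot E + normal E) (foot F + normal F).

Section Nets.
Variable n : nat.

Definition shift (j : 'I_n) (i : 'rV[int]_n) : 'rV[int]_n := i + delta_mx 0 j.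

Definition principal_net (c : 'rV[int]_n -> contact_element) : Prop :=
  forall i j, common_tangent_sphere (c i) (c (shift j i)).

Definition rotation_net (a : 'rV[int]_n -> proj7) : Prop :=
  (forall i, is_displacement (a i)) /\
  (forall i j, in_study_quadric (joining_line (a i) (a (shift j i)))).

Definition is_trajectory (a : 'rV[int]_n -> proj7) (E : contact_element)
    (c : 'rV[int]_n -> contact_element) : Prop :=
  forall i, maps_contact (a i) E (c i).

End Nets.

End Kinematics.

(* Main.v *)
Require Import Defs.
From mathcomp Require Import all_boot all_order all_algebra.
From mathcomp Require Import ring.
From mathcomp Require Import boolp classical_sets functions cardinality reals.

(** Take the contact element at the origin with normal [e1], the first basis
    vector, in the moving space.  A displacement with rotation part the
    quaternion [u] and translation part [t] is represented by the dual
    quaternion [u - eps (t u) / 2] ([pose]), and it carries this contact element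
    to [(p, nu)] exactly when [t = p] and [nu u = u e1].  Such a [u] exists for
    every unit vector [nu] ([aligning_quat]): for [nu != - e1] the
    half-turn about the bisector of [nu] and [e1].

    The point is that the edge condition of a rotation net holds for every
    choice of the quaternions [u] ([study_form_pose]).  A common tangent sphere
    of neighbours of signed radius [r] gives [p' - p = r (nu - nu')].  The
    relative rotation of the two positions takes [nu] to [nu'], so its axis is
    orthogonal to [nu - nu'], hence to the relative translation [p' - p]: this is
    what conjugacy with respect to the Study quadric means.

    The freedom left is, independently at every vertex, a preliminary rotation
    of the moving space about [e1], that is, a right factor [1 + k e1] of [u].
    The values [k = 0, 1, 2, ...], used simultaneously at all vertices, give
    pairwise distinct rotation nets. *)

Set Implicit Arguments.
Unset Strict Implicit.
Unset Printing Implicit Defensive.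

Import Order.TTheory GRing.Theory Num.Theory.
Local Open Scope ring_scope.
Local Open Scope classical_set_scope.

Section RotationNets.
Variable R : realType.
Notation quat := 'rV[R]_4.
Notation vec := 'rV[R]_3.
Notation dquat := 'rV[R]_(4 + 4).
Implicit Types (u p q : quat) (t x y : vec) (a b : dquat).

(** * Quaternion algebra *)

Lemma dotvC (k : nat) (x y : 'rV[R]_k) : dotv x y = dotv y x.
Proof. by rewrite /dotv -[x *m _]trmxK mxE trmx_mul trmxK. Qed.

Lemma dotvDl (k : nat) (x y z : 'rV[R]_k) :
  dotv (x + y) z = dotv x z + dotv y z.
Proof. by rewrite /dotv mulmxDl mxE. Qed.

Lemma dotvZl (k : nat) (c : R) (x y : 'rV[R]_k) :
  dotv (c *: x) y = c * dotv x y.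
Proof. by rewrite /dotv -scalemxAl mxE. Qed.

Lemma dotvNl (k : nat) (x y : 'rV[R]_k) : dotv (- x) y = - dotv x y.
Proof. by rewrite /dotv mulNmx mxE. Qed.

Lemma sqr_enorm (k : nat) (x : 'rV[R]_k) : enorm x ^+ 2 = dotv x x.
Proof.
by rewrite sqr_sqrtr // /dotv mxE sumr_ge0 // => i _; rewrite mxE -expr2 sqr_ge0.
Qed.

Lemma qmulDl p q u : qmul (p + q) u = qmul p u + qmul q u.
Proof. by apply: rV4P; rewrite !(mkquatE, mxE) /=; ring. Qed.

Lemma qmulDr p q u : qmul u (p + q) = qmul u p + qmul u q.
Proof. by apply: rV4P; rewrite !(mkquatE, mxE) /=; ring. Qed.

Lemma qmulZl (c : R) p q : qmul (c *: p) q = c *: qmul p q.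
Proof. by apply: rV4P; rewrite !(mkquatE, mxE) /=; ring. Qed.

Lemma qmulZr (c : R) p q : qmul p (c *: q) = c *: qmul p q.
Proof. by apply: rV4P; rewrite !(mkquatE, mxE) /=; ring. Qed.

Lemma dotv_qmul p q : dotv (qmul p q) (qmul p q) = dotv p p * dotv q q.
Proof. by rewrite !dotv4E !mkquatE; ring. Qed.

Lemma qmul_neq0 p q : p != 0 -> q != 0 -> qmul p q != 0.
Proof.
by move=> p0 q0; rewrite -dotv_eq0 dotv_qmul mulf_neq0 // dotv_eq0.
Qed.

Lemma qmulI u : u != 0 -> injective (qmul u).
Proof.
by move=> u0 p q e; rewrite -[p]qmul1l -[q]qmul1l -(qmulVr u0) -!qmulA e.
Qed.

Lemma enorm_scale_inv u : u != 0 -> enorm ((enorm u)^-1 *: u) = 1.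
Proof.
move=> u0; have un0 : enorm u != 0 by rewrite -sqrf_eq0 sqr_enorm dotv_eq0.
rewrite {1}/enorm dotvZl dotvC dotvZl -sqr_enorm expr2 mulKf // mulVf //.
by rewrite sqrtr1.
Qed.

Lemma qvecD x y : qvec (x + y) = qvec x + qvec y.
Proof. by apply: rV4P; rewrite !(mkquatE, mxE) /= ?addr0. Qed.

Lemma qvecN x : qvec (- x) = - qvec x.
Proof. by apply: rV4P; rewrite !(mkquatE, mxE) /= ?oppr0. Qed.

Lemma qvecZ (c : R) x : qvec (c *: x) = c *: qvec x.
Proof. by apply: rV4P; rewrite !(mkquatE, mxE) /= ?mulr0. Qed.

Lemma dotv_qvecl x p q : dotv (qmul (qvec x) p) q = - dotv (qmul (qvec x) q) p.
Proof. by rewrite !dotv4E !mkquatE; ring. Qed.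

Lemma dotv_qvecr x p q : dotv (qmul p (qvec x)) q = - dotv (qmul q (qvec x)) p.
Proof. by rewrite !dotv4E !mkquatE; ring. Qed.

(** * Alignment of unit vectors *)

Definition e1 : vec := delta_mx 0 0.

Lemma e1_unit : enorm e1 = 1.
Proof.
rewrite /enorm /dotv mxE (bigD1 0) //= big1 => [|i i0]; rewrite !mxE /=.
  by rewrite mulr1 addr0 sqrtr1.
by rewrite (negPf i0) mul0r.
Qed.

Lemma qvec_e1 : qvec e1 = mkquat 0 1 0 0.
Proof. by rewrite /qvec !mxE. Qed.

Lemma qvec_sqr_unit x : enorm x = 1 -> qmul (qvec x) (qvec x) = - qone R.
Proof.
move=> x1; have := sqr_enorm x.
rewrite /dotv mxE !big_ord_recl big_ord0 !mxE addr0.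
rewrite (_ : lift 0 0 = 1 :> 'I_3); last exact/val_inj.
rewrite (_ : lift 0 (lift 0 0) = 2 :> 'I_3); last exact/val_inj.
rewrite x1 expr1n => xx.
by apply: rV4P; rewrite !(mkquatE, mxE) /= ?xx; ring.
Qed.

(** For unit vectors [x] and [e1], [x (x + e1) = -1 + x e1 = (x + e1) e1].  Only
    [x = - e1] is exceptional; there any half-turn about an axis orthogonal to
    [e1] does. *)
Lemma aligning_quat x : enorm x = 1 ->
  exists2 u, u != 0 & qmul (qvec x) u = qmul u (qvec e1).
Proof.
move=> x1; have [xe|xe] := eqVneq (qvec x + qvec e1) 0.
  exists (mkquat 0 0 1 0).
    by rewrite -dotv_eq0 dotv4E !mkquatE !mul0r mul1r !add0r addr0 oner_eq0.
  rewrite (canRL (addrK _) xe) sub0r qvec_e1.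
  by apply: rV4P; rewrite !(mkquatE, mxE) /=; ring.
exists (qvec x + qvec e1) => //.
by rewrite qmulDr qmulDl !qvec_sqr_unit ?e1_unit // addrC.
Qed.

(** Up to scale, the quaternions of the rotations about [e1] other than the
    half-turn. *)
Definition twist (k : R) : quat := mkquat 1 k 0 0.

Lemma twist_neq0 k : twist k != 0.
Proof. by apply/eqP => /rowP /(_ 0); rewrite !mxE => /eqP; rewrite oner_eq0. Qed.

Lemma twist_e1 k : qmul (twist k) (qvec e1) = qmul (qvec e1) (twist k).
Proof. by rewrite qvec_e1; apply: rV4P; rewrite !mkquatE; ring. Qed.

(** * Displacements with prescribed rotation and translation part *)

(** The displacement [x |-> u x u^-1 + t]; for a dual quaternion [u + eps v]
    the translation part is [- 2 v u^-1], whence the factor [- 1 / 2]. *)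
Definition pose t u : dquat := row_mx u (- 2^-1 *: qmul (qvec t) u).

Lemma primal_pose t u : primal (pose t u) = u.
Proof. exact: row_mxKl. Qed.

Lemma dual_pose t u : dual (pose t u) = - 2^-1 *: qmul (qvec t) u.
Proof. exact: row_mxKr. Qed.

Lemma poseZ (c : R) t u : pose t (c *: u) = c *: pose t u.
Proof. by rewrite /pose scale_row_mx qmulZr !scalerA mulrC. Qed.

Lemma pose_neq0 t u : u != 0 -> pose t u != 0.
Proof.
apply: contraNN => /eqP e; rewrite -(primal_pose t u) e.
by rewrite /primal linear0.
Qed.

Lemma pose_image t u x y : u != 0 ->
    qmul (qvec (y - t)) u = qmul u (qvec x) ->
  dqpoint y = dqmul (dqmul (eps_conj (pose t u)) (dqpoint x))
                    (dqinv (pose t u)).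
Proof.
move=> u0 e; rewrite /dqmul /dqinv /eps_conj /dqpoint.
rewrite /primal /dual !row_mxKl !row_mxKr.
rewrite qmul1r qmulV //; congr row_mx.
rewrite qmulNr !qmulA qmulV // qmul1l -e qmulNl qmul1r !qmulDl qmulNl !qmulZl.
rewrite -!qmulA qmulV // !qmul1r qvecD qvecN.
by apply: rV4P; rewrite !(mkquatE, mxE) /=; field.
Qed.

(** Left multiplication by [t] is skew, so the form only sees the difference
    [t' - t], and it pairs this difference with the axis of the relative
    rotation.  Contributions of [nu] and of [nu'] cancel, because right
    multiplication by [x] is skew too. *)
Lemma study_form_pose (t t' nu nu' x : vec) (r : R) u u' :
    qmul (qvec nu) u = qmul u (qvec x) ->
    qmul (qvec nu') u' = qmul u' (qvec x) ->
    t' = t + r *: (nu - nu') ->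
  study_form (pose t u) (pose t' u') = 0.
Proof.
move=> eu eu' ->; rewrite study_formE !primal_pose !dual_pose dotvC !dotvZl.
rewrite qvecD qvecZ qvecD qvecN !qmulDl qmulZl qmulDl qmulNl.
rewrite !dotvDl dotvZl dotvDl dotvNl.
rewrite (dotv_qvecl t u') (dotv_qvecl nu u') eu eu' (dotv_qvecr x u').
ring.
Qed.

Lemma study_form_pose_self t u : study_form (pose t u) (pose t u) = 0.
Proof.
rewrite study_formE !primal_pose !dual_pose dotvC !dotvZl.
have : dotv (qmul (qvec t) u) u = 0 by rewrite !dotv4E !mkquatE; ring.
by move=> ->; rewrite mulr0 addr0.
Qed.

(** * Common tangent spheres *)

(** On an axis, position and oriented distance agree, so the centre of the sphere
    is the foot point plus the same multiple [r] of the normal on both axes. *)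
Lemma common_tangent_sphere_foot (E F : contact_element R) :
    common_tangent_sphere E F ->
  exists r, foot F = foot E + r *: (normal E - normal F).
Proof.
have dist (G : contact_element R) r :
    oriented_dist G (foot G + r *: normal G) = r.
  rewrite /oriented_dist addrAC subrr add0r dotvZl -sqr_enorm normal_unit.
  by rewrite expr1n mulr1.
move=> [_ [[r _ <-] [s _ e]]]; rewrite -{2}e !dist => rs; exists r.
by rewrite scalerBr addrA -e rs addrK.
Qed.

(** * Points and lines of the Study quadric *)

Definition proj_point a (a0 : a != 0) : proj7 R :=
  exist _ <[a]>%VS (introT eqP (etrans (dim_vline a) (congr1 nat_of_bool a0))).

Lemma study_form_comb (k l : R) a b :
  study_form (k *: a + l *: b) (k *: a + l *: b) =
  k ^+ 2 * study_form a a + 2 * k * l * study_form a b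
  + l ^+ 2 * study_form b b.
Proof.
rewrite /study_form !mulr_sumr -!big_split /=.
by apply: eq_bigr => i _; rewrite !mxE; ring.
Qed.

Lemma joining_line_in_study a b (a0 : a != 0) (b0 : b != 0) :
    study_form a a = 0 -> study_form b b = 0 -> study_form a b = 0 ->
  in_study_quadric (joining_line (proj_point a0) (proj_point b0)).
Proof.
move=> aa bb ab v /memv_addP[_ /vlineP[k ->] [_ /vlineP[l ->] ->]].
by rewrite study_form_comb aa bb ab !mulr0 !addr0.
Qed.

Definition pose_point t u (u0 : u != 0) : proj7 R :=
  proj_point (pose_neq0 t u0).

Lemma pose_point_displacement t u (u0 : u != 0) :
  is_displacement (pose_point t u0).
Proof.
split=> v /vlineP[k ->]; rewrite -poseZ; first exact: study_form_pose_self.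
rewrite primal_pose; apply: contraNN => /eqP ->.
by rewrite -(scale0r u) poseZ scale0r.
Qed.

Lemma pose_point_maps t u (u0 : u != 0) x y :
    qmul (qvec (y - t)) u = qmul u (qvec x) ->
  maps_point (pose_point t u0) x y.
Proof.
move=> e; set c := (enorm u)^-1.
have n1 : enorm (c *: u) = 1 by exact: enorm_scale_inv.
exists (pose t (c *: u)); rewrite primal_pose; split=> //.
  by rewrite poseZ memvZ // memv_line.
apply: pose_image; last by rewrite qmulZr qmulZl e.
apply: contra_eq_neq n1 => ->.
by rewrite /enorm /dotv mul0mx mxE sqrtr0 eq_sym oner_neq0.
Qed.

(** Equality of the two points makes [u (1 + k e1)] and [u (1 + l e1)]
    proportional; comparison of the real parts of [1 + k e1] and [1 + l e1]
    shows that the factor is [1]. *)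
Lemma pose_point_twist_inj t u (k l : R) (u0 : u != 0)
    (uk : qmul u (twist k) != 0) (ul : qmul u (twist l) != 0) :
  pose_point t uk = pose_point t ul -> k = l.
Proof.
move=> /(congr1 val) /= e.
have /vlineP[c] : pose t (qmul u (twist k)) \in <[pose t (qmul u (twist l))]>%VS.
  by rewrite -e memv_line.
rewrite -poseZ => /(congr1 (@primal R)); rewrite !primal_pose -qmulZr.
move=> /(qmulI u0) ekl.
have := congr1 (fun q : quat => q 0 0) ekl.
have := congr1 (fun q : quat => q 0 1) ekl.
by rewrite !mxE /= mulr1 => -> <-; rewrite mul1r.
Qed.

End RotationNets.

Theorem mainTheorem1 (R : realType) (n : nat) (hn : (1 <= n)%N)
    (c : 'rV[int]_n -> contact_element R) (hc : principal_net c) :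
  exists E : contact_element R,
    infinite_set [set a : 'rV[int]_n -> proj7 R |
                   rotation_net a /\ is_trajectory a E c].
Proof.
have /choice[u uP] (i : 'rV[int]_n) : exists u : 'rV[R]_4,
    u != 0 /\ qmul (qvec (normal (c i))) u = qmul u (qvec (e1 R)).
  by have [u] := aligning_quat (normal_unit (c i)); exists u.
pose w (k : nat) i := qmul (u i) (twist k%:R).
have w0 k i : w k i != 0 by rewrite qmul_neq0 ?twist_neq0 ?(uP i).1.
have wP k i : qmul (qvec (normal (c i))) (w k i) = qmul (w k i) (qvec (e1 R)).
  by rewrite /w qmulA (uP i).2 -!qmulA twist_e1.
pose a (k : nat) i := pose_point (foot (c i)) (w0 k i).
exists (ContactElement 0 (e1_unit R)) => fin_nets.
apply: infinite_nat.
have a_inj : injective a.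
  move=> k l /(congr1 (@^~ 0)) /(pose_point_twist_inj (uP 0).1) /eqP.
  by rewrite eqr_nat => /eqP.
apply: (sub_finite_set _ (finite_preimage (in2W a_inj) fin_nets)) => k _ /=.
split; first split=> [i|i j]; first exact: pose_point_displacement.
  apply: joining_line_in_study; try exact: study_form_pose_self.
  have [r] := common_tangent_sphere_foot (hc i j).
  exact: study_form_pose (wP k i) (wP k _).
move=> i; split; apply: pose_point_maps => /=.
  by rewrite subrr; apply: rV4P; rewrite !(mkquatE, mxE) /=; ring.
by rewrite add0r addrC addKr.
Qed.
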